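(* If $r\ge 7$ is an integer, then the triangle group $\Delta(2,3,r)$ and the extended triangle group $\Delta[2,3,r]$ each have uncountably many conjugacy classes of maximal subgroups of infinite index.
   Context: $\Delta(2,3,r)=\langle X,Y,Z\mid X^2=Y^3=Z^r=XYZ=1\rangle$ is the (orientation-preserving) triangle group of type $(2,3,r)$. $\Delta[2,3,r]$ is the extended triangle group of the same type, generated by the reflections in the sides of a hyperbolic triangle with angles $\pi/2,\pi/3,\pi/r$; it has presentation $\langle R_1,R_2,R_3\mid R_1^2=R_2^2=R_3^2=(R_1R_2)^2=(R_2R_3)^3=(R_3R_1)^r=1\rangle$ and contains $\Delta(2,3,r)$ as its orientation-preserving subgroup of index $2$. A maximal subgroup is a maximal proper subgroup. *)

(* Defs.v *)
From HB Require Import structures.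
From mathcomp Require Import all_boot generic_quotient.
From mathcomp Require Import boolp classical_sets functions cardinality.

Set Implicit Arguments.
Unset Strict Implicit.
Unset Printing Implicit Defensive.

Local Open Scope group_scope.
Local Open Scope classical_set_scope.

Section Presentation.
Variable I : choiceType.

(* The letter (i, false) is the generator i, (i, true) its formal inverse. *)
Definition letter : Type := (I * bool)%type.
Definition word : Type := seq letter.

Definition letterV (a : letter) : letter := (a.1, ~~ a.2).
Definition wordV (w : word) : word := rev (map letterV w).
Definition wordX (w : word) (n : nat) : word := flatten (nseq n w).

Variable rels : seq word.

(* Equality in < I | rels >: the equivalence relation on words generated by
   insertion and deletion of subwords a a^-1 and of relators. *)
Inductive weq : word -> word -> Prop :=
| weq_refl u : weq u u
| weq_sym u v : weq u v -> weq v u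
| weq_trans u v w : weq u v -> weq v w -> weq u w
| weq_cancel u a v : weq (u ++ [:: a; letterV a] ++ v) (u ++ v)
| weq_rel u r v : r \in rels -> weq (u ++ r ++ v) (u ++ v).

Definition weqb (u v : word) : bool := `[< weq u v >].

Lemma weqb_refl : reflexive weqb.
Proof. by move=> u; apply/asboolP; exact: weq_refl. Qed.

Lemma weqb_sym : symmetric weqb.
Proof. by move=> u v; apply/asboolP/asboolP; exact: weq_sym. Qed.

Lemma weqb_trans : transitive weqb.
Proof.
move=> v u w /asboolP uv /asboolP vw; apply/asboolP; exact: weq_trans uv vw.
Qed.

Canonical weqb_equiv := EquivRel weqb weqb_refl weqb_sym weqb_trans.

Definition presented : Type := {eq_quot weqb}%qT.
HB.instance Definition _ := Choice.on presented.
HB.instance Definition _ := EqQuotient.on presented.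

Definition word_class (w : word) : presented := (\pi_presented w)%qT.

Lemma word_classP u v : word_class u = word_class v <-> weq u v.
Proof.
split=> [/eqP|uv]; first by rewrite /word_class eqmodE => /asboolP.
by apply/eqP; rewrite /word_class eqmodE; apply/asboolP.
Qed.

Lemma word_class_ind (P : presented -> Prop) :
  (forall w, P (word_class w)) -> forall x, P x.
Proof. by move=> Pw x; rewrite -[x]reprK; exact: Pw. Qed.

Lemma weq_catl w u v : weq u v -> weq (w ++ u) (w ++ v).
Proof.
elim=> {u v} [u|u v _|u v s _ uv _|u a v|u r v rr].
- exact: weq_refl.
- exact: weq_sym.
- exact: weq_trans uv.
- by rewrite !(catA w u); exact: weq_cancel.
- by rewrite !(catA w u); exact: weq_rel.
Qed.

Lemma weq_catr w u v : weq u v -> weq (u ++ w) (v ++ w).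
Proof.
elim=> {u v} [u|u v _|u v s _ uv _|u a v|u r v rr].
- exact: weq_refl.
- exact: weq_sym.
- exact: weq_trans uv.
- by rewrite -!catA; exact: weq_cancel.
- by rewrite -!catA; exact: weq_rel.
Qed.

Lemma letterVK : involutive letterV.
Proof. by case=> i b; rewrite /letterV /= negbK. Qed.

Lemma wordV_cat u v : wordV (u ++ v) = wordV v ++ wordV u.
Proof. by rewrite /wordV map_cat rev_cat. Qed.

Lemma wordVK : involutive wordV.
Proof. by move=> w; rewrite /wordV map_rev revK mapK //; exact: letterVK. Qed.

Lemma weq_catwV w : weq (w ++ wordV w) [::].
Proof.
elim/last_ind: w => [|w a IHw]; first exact: weq_refl.
rewrite -cats1 wordV_cat -catA.
exact: weq_trans (weq_cancel w a (wordV w)) IHw.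
Qed.

Lemma weq_catVw w : weq (wordV w ++ w) [::].
Proof. by rewrite -{2}[w]wordVK; exact: weq_catwV. Qed.

Lemma weq_wordV u v : weq u v -> weq (wordV u) (wordV v).
Proof.
move=> uv; apply: (@weq_trans _ (wordV u ++ (v ++ wordV v))).
  apply: weq_sym; rewrite -[X in weq _ X]cats0.
  exact/weq_catl/weq_catwV.
apply: (@weq_trans _ (wordV u ++ (u ++ wordV v))).
  exact/weq_catl/weq_catr/weq_sym.
rewrite catA -[X in weq _ X]cat0s; exact/weq_catr/weq_catVw.
Qed.

Definition pres_mul (x y : presented) : presented :=
  word_class (repr x ++ repr y).
Definition pres_inv (x : presented) : presented := word_class (wordV (repr x)).

Lemma weq_repr w : weq (repr (word_class w)) w.
Proof. by apply/word_classP; rewrite /word_class reprK. Qed.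

Lemma pres_mulE u v :
  pres_mul (word_class u) (word_class v) = word_class (u ++ v).
Proof.
apply/word_classP; apply: weq_trans (weq_catr _ (weq_repr u)) _.
exact/weq_catl/weq_repr.
Qed.

Lemma pres_invE u : pres_inv (word_class u) = word_class (wordV u).
Proof. exact/word_classP/weq_wordV/weq_repr. Qed.

Lemma pres_mulA : associative pres_mul.
Proof.
elim/word_class_ind=> u; elim/word_class_ind=> v; elim/word_class_ind=> w.
by rewrite !pres_mulE catA.
Qed.

Lemma pres_mul1 : left_id (word_class [::]) pres_mul.
Proof. by elim/word_class_ind=> u; rewrite pres_mulE. Qed.

Lemma pres_1mul : right_id (word_class [::]) pres_mul.
Proof. by elim/word_class_ind=> u; rewrite pres_mulE cats0. Qed.

Lemma pres_mulV : left_inverse (word_class [::]) pres_inv pres_mul.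
Proof.
elim/word_class_ind=> u; rewrite pres_invE pres_mulE; apply/word_classP.
exact: weq_catVw.
Qed.

Lemma pres_Vmul : right_inverse (word_class [::]) pres_inv pres_mul.
Proof.
elim/word_class_ind=> u; rewrite pres_invE pres_mulE; apply/word_classP.
exact: weq_catwV.
Qed.

HB.instance Definition _ := isGroup.Build presented
  pres_mulA pres_mul1 pres_1mul pres_mulV pres_Vmul.

Definition generator (i : I) : presented := word_class [:: (i, false)].

End Presentation.

Section UniversalProperty.
Variables (I : choiceType) (rels : seq (word I)).

Definition weval (G : groupType) (f : I -> G) (w : word I) : G :=
  foldr (fun a x => (if a.2 then (f a.1)^-1 else f a.1) * x) 1 w.

Lemma weval_cat (G : groupType) (f : I -> G) u v :
  weval f (u ++ v) = weval f u * weval f v.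
Proof. by elim: u => [|a u IHu] /=; rewrite ?mul1g // IHu mulgA. Qed.

Lemma weval_generator (w : word I) :
  weval (generator rels) w = word_class rels w.
Proof.
elim: w => [//|[i b] w IHw] /=; rewrite IHw.
have -> : (if b then (generator rels i)^-1 else generator rels i) =
  word_class rels [:: (i, b)] by case: b; rewrite // [LHS]pres_invE.
exact: pres_mulE.
Qed.

Lemma weval_rel r : r \in rels -> weval (generator rels) r = 1.
Proof.
move=> rr; rewrite weval_generator; apply/word_classP.
by have := @weq_rel _ rels [::] r [::] rr; rewrite cat0s cats0.
Qed.

Lemma presented_lift (G : groupType) (f : I -> G) :
    (forall r, r \in rels -> weval f r = 1) ->
  exists! phi : presented rels -> G,
    {morph phi : x y / x * y} /\ (forall i, phi (generator rels i) = f i).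
Proof.
move=> fr.
have f_weq u v : weq rels u v -> weval f u = weval f v.
  elim=> {u v} [//|//|u v w _ -> _ -> //|u [i b] v|u r v rr].
    rewrite !weval_cat /=; congr (_ * _); rewrite mulg1 /letterV /=.
    by case: b; rewrite /= ?mulVg ?mulgV mul1g.
  by rewrite !weval_cat (fr r rr) mul1g.
pose phi (x : presented rels) := weval f (repr x).
have phiE w : phi (word_class rels w) = weval f w.
  exact/f_weq/weq_repr.
exists phi; split; first split.
- elim/word_class_ind=> u; elim/word_class_ind=> v.
  by rewrite [_ * _]pres_mulE !phiE weval_cat.
- by move=> i; rewrite phiE /= mulg1.
move=> psi [psiM psig]; apply/funext; elim/word_class_ind=> w; rewrite phiE.
have psi1 : psi 1 = 1.
  by apply: (mulgI (psi 1)); rewrite -psiM !mulg1.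
have psiV x : psi x^-1 = (psi x)^-1.
  by apply: (mulgI (psi x)); rewrite -psiM !mulgV.
rewrite -weval_generator; elim: w => [|[i b] w IHw] /=; first by rewrite psi1.
by rewrite psiM IHw; case: b; rewrite ?psiV psig.
Qed.

End UniversalProperty.

Section Triangle.
Variables p q r : nat.

Let g (i : 'I_3) : word 'I_3 := [:: (i, false)].
Let w0 := g (@Ordinal 3 0 isT).
Let w1 := g (@Ordinal 3 1 isT).
Let w2 := g (@Ordinal 3 2 isT).

(* X, Y, Z are the generators of index 0, 1, 2. *)
Definition triangle_rels : seq (word 'I_3) :=
  [:: wordX w0 p; wordX w1 q; wordX w2 r; w0 ++ w1 ++ w2].

Definition triangle : groupType := presented triangle_rels.

(* Coxeter presentation of the group generated by the reflections R_1, R_2, R_3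
   (generators of index 0, 1, 2) in the sides of a triangle with angles pi/p,
   pi/q, pi/r, hyperbolic when 1/p + 1/q + 1/r < 1. *)
Definition ext_triangle_rels : seq (word 'I_3) :=
  [:: wordX w0 2; wordX w1 2; wordX w2 2;
      wordX (w0 ++ w1) p; wordX (w1 ++ w2) q; wordX (w2 ++ w0) r].

Definition ext_triangle : groupType := presented ext_triangle_rels.

End Triangle.

Section Subgroups.
Variable G : groupType.
Implicit Types H K : set G.

Definition is_subgroup H : Prop := group_closed [in H].

Definition maximal_subgroup H : Prop :=
  [/\ is_subgroup H, H <> [set: G] &
      forall K, is_subgroup K -> H `<=` K -> K = H \/ K = [set: G]].

Definition left_cosets H : set (set G) :=
  [set [set x * h | h in H] | x in [set: G]].

Definition infinite_index H : Prop := infinite_set (left_cosets H).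

Definition conjugacy_class H : set (set G) :=
  [set [set h ^ x | h in H] | x in [set: G]].

Definition max_inf_classes : set (set (set G)) :=
  [set conjugacy_class H | H in [set H | maximal_subgroup H /\
                                         infinite_index H]].

End Subgroups.

Arguments max_inf_classes : clear implicits.

(* Main.v *)
From Stdlib Require Import Reals Lra.
Require Import Defs.
From mathcomp Require Import all_boot.
From mathcomp Require Import boolp classical_sets functions cardinality.

(** Both groups act on the hyperbolic plane, and the maximal subgroups come from
    a game of ping-pong there.

    Write c = 2 cos (pi / r).  A point is encoded by the triple (x, y, z) of the
    values of the linear forms that vanish on the three sides of the triangle;
    the reflections R_1, R_2, R_3 act linearly on such triples with coefficients
    in Z[c], and r >= 7 enters only through c >= 9 / 5 and through the order of
    the rotation R_3 R_1.  The triangle group acts through the homomorphism that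
    sends X, Y, Z to R_1 R_2, R_2 R_3, R_3 R_1.

    Two mirrors A and B of the tessellation are exhibited
    ([cartan_rootA_rootB], [regionAB_wedge]) that bound disjoint half-planes, both
    inside the region beyond the first side and between the prolongations of the
    other two.  That region is moved off itself by the nontrivial elements of
    <R_1, R_2> and <R_3>, and also by those of <X> and <Y>.  So in either group G
    there are two finite subgroups Gamma_true and Gamma_false which together
    generate G and whose nontrivial elements send the union of the two half-planes
    into its complement, while the product h of the reflections in A and B, a
    translation, sends the complement of the first half-plane into the second.

    Hence the complement of the two half-planes has disjoint translates under the
    powers of h, and for any sequence xi of booleans the conjugates of
    Gamma_(xi j) by h ^ ((j+1)!) play ping-pong: the subgroup that they generate
    moves a base point only into these translates, so it is proper
    ([pingpong_proper]), and as G is finitely generated it lies in a maximal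
    subgroup M_xi ([maximal_subgroup_above]).

    If xi and xi' differ at j, a subgroup containing the conjugates for both
    sequences contains Gamma_true and Gamma_false conjugated by the same element,
    and these generate G, so M_xi <> M_xi'.  If M_xi had finite
    index it would contain a power h ^ k with k > 0, hence all h ^ ((j+1)!) with
    j >= k, hence the unconjugated Gamma_(xi j); when xi takes both values
    beyond k this makes M_xi the whole group.  Uncountably many sequences take both
    values on each pair of indices 2n, 2n+1, so there are uncountably many maximal
    subgroups of infinite index; as G is countable, so is each conjugacy class,
    and there are uncountably many classes ([pingpong_uncountable]). *)

Set Implicit Arguments.
Unset Strict Implicit.
Unset Printing Implicit Defensive.

Local Open Scope group_scope.
Local Open Scope classical_set_scope.

(** * Maximal subgroups of countable groups *)

Lemma uncountable_binary_sequences : ~ countable [set: nat -> bool].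
Proof.
move=> /countable_injP[f finj].
pose d n := ~~ `[< exists2 e : nat -> bool, f e = n & e n >].
have [dn|dn] : d (f d) \/ ~ d (f d) by case: (d (f d)); [left|right].
  by have /asboolPn[] := dn; exists d.
have /negP/negPn/asboolP[e fe en] := dn.
by apply: dn; rewrite -{1}(finj e d (mem_setT _) (mem_setT _) fe).
Qed.

Section Subgroups.
Variable G : groupType.
Implicit Types (H K M : set G) (x y : G).

Lemma is_subgroupP H :
  is_subgroup H <-> H 1 /\ forall x y, H x -> H y -> H (x * y^-1).
Proof.
split=> [[H1 HB]|[H1 HB]].
  split=> [|x y Hx Hy]; first by move: H1; rewrite inE.
  by have := HB x y; rewrite !inE; apply.
by split=> [|x y]; rewrite !inE //; exact: HB.
Qed.

Lemma subgroup1 H : is_subgroup H -> H 1.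
Proof. by case/is_subgroupP. Qed.

Lemma subgroupV H x : is_subgroup H -> H x -> H x^-1.
Proof. by case/is_subgroupP=> H1 HB Hx; rewrite -[x^-1]mul1g; exact: HB. Qed.

Lemma subgroupM H x y : is_subgroup H -> H x -> H y -> H (x * y).
Proof.
move=> sH Hx Hy; rewrite -[y]invgK.
by case/is_subgroupP: (sH) => _; apply=> //; exact: subgroupV.
Qed.

Lemma subgroupX H x n : is_subgroup H -> H x -> H (x ^+ n).
Proof.
move=> sH Hx; elim: n => [|n IHn]; first exact: subgroup1.
by rewrite expgS; exact: subgroupM.
Qed.

(** Finite generation is what keeps the union of a chain of proper subgroups
    proper: otherwise a single member would contain all the generators. *)
Lemma maximal_subgroup_above (gens : seq G) H :
    (forall K, is_subgroup K -> (forall x, x \in gens -> K x) -> K = [set: G]) ->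
    is_subgroup H -> H <> [set: G] ->
  exists2 M, maximal_subgroup M & H `<=` M.
Proof.
move=> gensP sH HT.
(* The empty set is admitted because it is the union of the empty chain. *)
pose P K := K = set0 \/ [/\ is_subgroup K, H `<=` K & K <> [set: G]].
have [F FP totF|M [PM maxM]] := @Zorn_bigcup G P.
  have FsubP K : F K -> K !=set0 -> [/\ is_subgroup K, H `<=` K & K <> [set: G]].
    by move=> FK K0; case: (FP K FK) => // K0'; case: K0 => y; rewrite K0'.
  have [[K [FK K0]]|F0] := pselect (exists K, F K /\ K !=set0); last first.
    left; rewrite -subset0 => x [K FK Kx]; apply: F0.
    by exists K; split=> //; exists x.
  right; have [sK HK KT] := FsubP K FK K0; split.
  - apply/is_subgroupP; split; first by exists K => //; exact: subgroup1.
    move=> x y [X FX Xx] [Y FY Yy].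
    have [sX _ _] : [/\ is_subgroup X, H `<=` X & X <> [set: G]].
      by apply: FsubP => //; exists x.
    have [sY _ _] : [/\ is_subgroup Y, H `<=` Y & Y <> [set: G]].
      by apply: FsubP => //; exists y.
    by have [XY|YX] := totF X Y FX FY;
      [exists Y => //; move/XY: Xx | exists X => //; move/YX: Yy] => Zz;
      apply: subgroupM => //; exact: subgroupV.
  - by move=> x Hx; exists K => //; exact: HK.
  move=> UT; have [L [FL L0 Lgens]] :
      exists L, [/\ F L, L !=set0 & forall x, x \in gens -> L x].
    elim: gens {gensP} => [|x s [L [FL L0 Ls]]]; first by exists K.
    have : [set: G] x by [].
    rewrite -UT => -[X FX Xx].
    have [LX|XL] := totF L X FL FX.
      exists X; split=> //; first by exists x.
      by move=> y; rewrite inE => /orP[/eqP-> //|/Ls]; exact: LX.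
    by exists L; split=> // y; rewrite inE => /orP[/eqP->|/Ls //]; exact: XL.
  have [sL _] := FsubP L FL L0; apply; exact: gensP.
have {PM} [sM HM MT] : [/\ is_subgroup M, H `<=` M & M <> [set: G]].
  case: PM => // M0; case: (maxM H); last by right; split.
  rewrite M0; split=> // /(_ 1); apply; exact: subgroup1.
exists M => //; split=> // K sK MK.
have [KM|KM] := pselect (K `<=` M); first by left; apply/seteqP.
right; apply: contrapT => KT; apply: (maxM K); first by split.
by right; split=> // x /HM/MK.
Qed.

(** A conjugacy class of subgroups is an image of the group, hence countable. *)
Lemma countable_maximal_of_classes :
    countable [set: G] -> countable (max_inf_classes G) ->
  countable [set M : set G | maximal_subgroup M /\ infinite_index M].
Proof.
move=> cG cC; apply: (@sub_countable _ _ _ (\bigcup_(C in max_inf_classes G) C)).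
  apply: subset_card_le => M mM; exists (conjugacy_class M); first by exists M.
  exists 1 => //; apply/seteqP; split=> [_ [x Mx <-]|x Mx]; first by rewrite conjg1.
  by exists x => //; rewrite conjg1.
apply: bigcup_countable => // _ [M _ <-].
exact: sub_countable (card_image_le _ _) cG.
Qed.

(** Two of the cosets of 1, x, x ^ 2, ... coincide. *)
Lemma finite_index_expg M x : is_subgroup M -> ~ infinite_index M ->
  exists2 k, (0 < k)%N & M (x ^+ k).
Proof.
move=> sM finM; apply: contrapT => Mx; apply: finM; apply/infiniteP.
pose f n : set G := [set x ^+ n * y | y in M].
have finj : {in [set: nat] &, injective f}.
  suff le m n : (m < n)%N -> f m <> f n.
    by move=> m n _ _ fmn; case: (ltngtP m n) => // /le []; rewrite fmn.
  move=> mn fmn; apply: Mx; exists (n - m)%N; first by rewrite subn_gt0.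
  have : f n (x ^+ n) by exists 1; rewrite ?mulg1 //; exact: subgroup1.
  rewrite -fmn => -[y My xy].
  suff -> : x ^+ (n - m) = y by [].
  by apply: (mulgI (x ^+ m)); rewrite -expgnDr subnKC // ltnW.
have := inj_card_eq finj; rewrite card_eq_sym => /card_eqPle[le _].
apply: card_le_trans le _; apply: subset_card_le => _ [n _ <-].
by exists (x ^+ n).
Qed.

End Subgroups.

(** * Ping-pong *)

(** The subgroups [Gamma b] displace the union of A and B into D; [h] is a
    translation with repelling end A and attracting end B, and D lies in the
    strip between the two. *)
Section PingPong.
Variables (G : groupType) (T : Type) (act : G -> T -> T).
Hypothesis act1 : forall v, act 1 v = v.
Hypothesis actM : forall g h v, act (g * h) v = act g (act h v).

Variables (Gamma : bool -> set G) (gens : seq G).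
Hypothesis Gamma_subgroup : forall b, is_subgroup (Gamma b).
Hypothesis Gamma_gen : forall K, is_subgroup K ->
  (forall b, Gamma b `<=` K) -> K = [set: G].
Hypothesis gens_gen : forall K, is_subgroup K ->
  (forall x, x \in gens -> K x) -> K = [set: G].
Hypothesis countG : countable [set: G].

Variables (h : G) (A B D : set T).
Hypothesis AB_D : forall v, (A `|` B) v -> ~ D v.
Hypothesis Gamma_D : forall b g v,
  Gamma b g -> g <> 1 -> (A `|` B) v -> D (act g v).
Hypothesis h_B : forall v, (D `|` B) v -> B (act h v).
Hypothesis h_A : forall v, (D `|` A) v -> A (act h^-1 v).
Variables (q : T) (b0 : bool) (g0 : G).
Hypothesis Aq : A q.
Hypothesis Gamma_g0 : Gamma b0 g0.
Hypothesis g0_neq1 : g0 <> 1.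

Let actVK g v : act g (act g^-1 v) = v.
Proof. by rewrite -actM mulgV act1. Qed.

Lemma hX_B n v : (D `|` B) v -> (0 < n)%N -> B (act (h ^+ n) v).
Proof.
move=> DBv; case: n => // n _; elim: n => [|n IHn]; first exact: h_B.
by rewrite expgS actM; apply: h_B; right.
Qed.

Lemma hX_A n v : (D `|` A) v -> (0 < n)%N -> A (act (h ^+ n)^-1 v).
Proof.
move=> DAv; case: n => // n _; rewrite -expVgn.
elim: n => [|n IHn]; first exact: h_A.
by rewrite expgS actM; apply: h_A; right.
Qed.

(** Thanks to the factorials, all but finitely many conjugators are powers of any
    given [h ^+ k] with k > 0. *)
Definition conjugator j : G := h ^+ (j.+1)`!.

Section Family.
Variable xi : nat -> bool.

Let D_ j : set T := [set v | D (act (conjugator j)^-1 v)].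
Let W_ j : set T := [set v | (A `|` B) (act (conjugator j)^-1 v)].

(** The translates of D are far apart: each lies in the ends of all others. *)
Lemma D_W i j v : i <> j -> D_ i v -> W_ j v.
Proof.
rewrite /D_ /W_ /= => ij Dv; rewrite -[v](actVK (conjugator i)) -actM.
set w := act _ v in Dv *; have [lt_ij|lt_ji|//] := ltngtP i j.
- left; have ltf : ((i.+1)`! < (j.+1)`!)%N by rewrite ltn_fact.
  have -> : (conjugator j)^-1 * conjugator i = (h ^+ ((j.+1)`! - (i.+1)`!))^-1.
    apply: invg_inj; rewrite invgK invgM invgK.
    by apply: (mulgI (conjugator i)); rewrite mulVKg -expgnDr subnKC // ltnW.
  by apply: hX_A; [left | rewrite subn_gt0].
- right; have ltf : ((j.+1)`! < (i.+1)`!)%N by rewrite ltn_fact.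
  have -> : (conjugator j)^-1 * conjugator i = h ^+ ((i.+1)`! - (j.+1)`!).
    by apply: (mulgI (conjugator j)); rewrite mulVKg -expgnDr subnKC // ltnW.
  by apply: hX_B; [left | rewrite subn_gt0].
Qed.

(** The orbit of [q], each point presented so that the last factor applied moved
    it from the ends of its index j into [D_ j]; this replaces reduced words. *)
Inductive reached : T -> Prop :=
| reached_base : reached q
| reached_step j g v : reached v -> W_ j v -> Gamma (xi j) g -> g <> 1 ->
    reached (act (g ^ (conjugator j)^-1) v).

(** Taking the setwise stabiliser of the reached points, rather than the subgroup
    generated by the conjugates, makes closure under the group operations
    immediate. *)
Definition pingpong_subgroup : set G :=
  [set g | forall v, reached (act g v) <-> reached v].

Lemma pingpong_is_subgroup : is_subgroup pingpong_subgroup.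
Proof.
apply/is_subgroupP; split=> [v|x y Hx Hy v]; first by rewrite act1.
by rewrite actM Hx -(Hy (act y^-1 v)) actVK.
Qed.

(** A new factor of index j either prolongs the word, when the point is not in
    [D_ j], or merges with the last factor, which has the same index. *)
Lemma pingpong_sub j g : Gamma (xi j) g ->
  pingpong_subgroup (g ^ (conjugator j)^-1).
Proof.
have step x v : Gamma (xi j) x -> reached v ->
    reached (act (x ^ (conjugator j)^-1) v).
  move=> Gx rv; have [->|x1] := pselect (x = 1); first by rewrite conj1g act1.
  case: rv => [|i y w rw Ww Gy y1].
    apply: reached_step => //; first exact: reached_base.
    by left; apply: hX_A; [right | rewrite fact_gt0].
  have [ij|ij] := pselect (i = j).
    subst i; rewrite -actM -conjMg.
    have [->|xy1] := pselect (x * y = 1); first by rewrite conj1g act1.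
    by apply: reached_step => //; exact: subgroupM.
  apply: reached_step => //; first exact: reached_step.
  apply: (D_W ij); rewrite /D_ /= -actM conjgE invgK !mulgA mulVg mul1g.
  by rewrite actM; exact: Gamma_D Gy y1 Ww.
move=> Gg v; split=> [|rv]; last exact: step.
move/(step g^-1); rewrite -actM -conjMg mulVg conj1g act1; apply.
exact: subgroupV.
Qed.

(** [act g0 q] is in D, whereas reached points other than [q] are in translates
    of D that lie in B, because the exponents of the conjugators are positive. *)
Lemma pingpong_proper : pingpong_subgroup <> [set: G].
Proof.
move=> HT; have : pingpong_subgroup g0 by rewrite HT.
move=> /(_ q) [_ /(_ reached_base)].
have Dq : D (act g0 q) by apply: Gamma_D Gamma_g0 g0_neq1 _; left.
move: Dq; move: (act g0 q) => v Dv rv; case: rv Dv => [|j g w _ Ww Gg g1].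
  by apply: AB_D; left.
apply: AB_D; right; rewrite conjgE invgK actM.
apply: hX_B; last exact: fact_gt0.
by left; rewrite actM; exact: Gamma_D Gg g1 Ww.
Qed.

End Family.

Lemma maximal_subgroup_family :
  exists M : (nat -> bool) -> set G, forall xi,
    maximal_subgroup (M xi) /\
    (forall j g, Gamma (xi j) g -> M xi (g ^ (conjugator j)^-1)).
Proof.
suff /boolp.choice[M MP] : forall xi : nat -> bool, exists M : set G,
    maximal_subgroup M /\
    (forall j g, Gamma (xi j) g -> M (g ^ (conjugator j)^-1)).
  by exists M.
move=> xi.
have [M maxM HM] := maximal_subgroup_above gens_gen (pingpong_is_subgroup xi)
  (@pingpong_proper xi).
by exists M; split=> // j g Gg; apply: HM; exact: pingpong_sub.
Qed.

Theorem pingpong_uncountable : ~ countable (max_inf_classes G).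
Proof.
move=> /(countable_maximal_of_classes countG) cM.
have [M MP] := maximal_subgroup_family.
(* xi e takes both values on each pair 2n, 2n+1, and its value at 2n is e n. *)
pose xi (e : nat -> bool) j := odd j (+) e j./2.
(* Conjugated by the same element, the two subgroups still generate G. *)
have Mproper N j : maximal_subgroup N ->
    ~ (forall b g, Gamma b g -> N (g ^ (conjugator j)^-1)).
  move=> [sN NT _] NG; apply: NT; apply/seteqP; split=> // x _.
  pose K := [set g | N (g ^ (conjugator j)^-1)].
  have KT : K = [set: G].
    apply: Gamma_gen NG; apply/is_subgroupP; split=> [|y z Ky Kz]; rewrite /K /=.
      by rewrite conj1g; exact: subgroup1.
    by rewrite conjMg conjVg; apply: subgroupM => //; exact: subgroupV.
  have : K (x ^ conjugator j) by rewrite KT.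
  by rewrite /K /= conjgK.
(* A power of h in M undoes the conjugation at all large indices. *)
have Minf e : infinite_index (M (xi e)).
  apply: contrapT => finM; have [maxM MG] := MP (xi e).
  have [sM _ _] := maxM.
  have [k k_gt0 Mhk] := finite_index_expg h sM finM.
  have Mconj j : (k <= j)%N -> M (xi e) (conjugator j).
    move=> kj; have /dvdnP[m jE] : (k %| (j.+1)`!)%N.
      by apply: dvdn_fact; rewrite k_gt0 (leq_trans kj).
    by rewrite /conjugator jE mulnC expgnA; exact: subgroupX.
  have MGam j g : (k <= j)%N -> Gamma (xi e j) g -> M (xi e) g.
    move=> kj /MG Mg; rewrite -[g](conjgKV (conjugator j)) conjgE.
    have Mc := Mconj j kj.
    by apply: subgroupM => //; [exact: subgroupV | exact: subgroupM].
  apply: (Mproper _ k.*2 maxM) => b g Gg.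
  have Mg : M (xi e) g.
    have [j kj xij] : exists2 j, (k <= j)%N & xi e j = b.
      have [<-|ekb] := eqVneq (e k) b.
        by exists k.*2; rewrite /xi ?odd_double ?doubleK // -addnn leq_addr.
      exists k.*2.+1; first by rewrite -addnn leqW ?leq_addr.
      by rewrite /xi /= odd_double uphalf_double; case: (b) (e k) ekb => [] [].
    by apply: (MGam j); rewrite ?xij.
  rewrite conjgE invgK; have Mc : M (xi e) (conjugator k.*2).
    by apply: Mconj; rewrite -addnn leq_addr.
  by do 2?apply: subgroupM => //; exact: subgroupV.
have Minj : injective (M \o xi).
  move=> e e' /= Mee'; apply/funext => n; apply: contrapT => en.
  have [maxM MG] := MP (xi e); have [_ MG'] := MP (xi e').
  rewrite -Mee' in MG'.
  apply: (Mproper _ n.*2 maxM) => b g Gg.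
  have := MG n.*2 g; have := MG' n.*2 g.
  rewrite /xi odd_double /= doubleK.
  by case: b Gg; case: (e n) en; case: (e' n) => // _ Gg ? ?; auto.
apply: uncountable_binary_sequences; apply: sub_countable cM.
have /inj_card_eq : {in [set: nat -> bool] &, injective (M \o xi)}.
  by move=> e e' _ _; exact: Minj.
rewrite card_eq_sym => /card_eqPle[le _]; apply: card_le_trans le _.
apply: subset_card_le => _ [e _ <-].
by split; [have [] := MP (xi e) | exact: Minf].
Qed.

End PingPong.

(** * The reflection representation *)

Definition i1 : 'I_3 := @Ordinal 3 0 isT.
Definition i2 : 'I_3 := @Ordinal 3 1 isT.
Definition i3 : 'I_3 := @Ordinal 3 2 isT.

Lemma ord3P (i : 'I_3) : [\/ i = i1, i = i2 | i = i3].
Proof.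
case: i => [[|[|[|//]]] lti]; [apply: Or31|apply: Or32|apply: Or33].
all: exact/val_inj.
Qed.

Section Geometry.
Local Open Scope R_scope.
Variable c : R.
Hypothesis c_ge : 9 / 5 <= c.

Definition vec : Type := (R * R * R)%type.
Implicit Types (v : vec) (s t : vec) (i : 'I_3) (w : seq 'I_3).

(** The Cartan matrix of the triangle has diagonal 2 and off-diagonal entries
    0 (sides 1, 2), -1 (sides 2, 3) and -c (sides 3, 1): minus twice the cosines
    of the angles.  Points are given by the values (x, y, z) of the simple roots,
    roots by their coordinates on the simple roots; the two actions of a
    reflection are transposes of each other. *)
Definition reflect_point i v : vec :=
  let: (x, y, z) := v in
  match val i with
  | 0%nat => (- x, y, z + c * x)
  | 1%nat => (x, - y, z + y)
  | _ => (x + c * z, y + z, - z)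
  end.

Definition reflect_root i s : vec :=
  let: (a, b, g) := s in
  match val i with
  | 0%nat => (- a + c * g, b, g)
  | 1%nat => (a, - b + g, g)
  | _ => (a, b, - g + b + c * a)
  end.

Definition pairing s v : R :=
  let: (a, b, g) := s in let: (x, y, z) := v in a * x + b * y + g * z.

Definition cartan s t : R :=
  let: (a, b, g) := s in let: (a', b', g') := t in
  2 * (a * a' + b * b' + g * g') - c * (a * g' + a' * g) - (b * g' + b' * g).

Definition apply_word w v : vec := foldr reflect_point v w.

Lemma reflect_pointK i : involutive (reflect_point i).
Proof.
by case=> [[x y] z]; case: (ord3P i) => -> /=; congr (_, _, _); ring.
Qed.

Lemma pairing_reflect i s v :
  pairing (reflect_root i s) v = pairing s (reflect_point i v).
Proof.
by case: s v => [[a b] g] [[x y] z]; case: (ord3P i) => -> /=; ring.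
Qed.

Lemma cartan_reflect i s t :
  cartan (reflect_root i s) (reflect_root i t) = cartan s t.
Proof.
by case: s t => [[a b] g] [[a' b'] g']; case: (ord3P i) => -> /=; ring.
Qed.

Lemma apply_word_cat w1 w2 v :
  apply_word (w1 ++ w2) v = apply_word w1 (apply_word w2 v).
Proof. exact: foldr_cat. Qed.

Lemma apply_word_revK w v : apply_word (rev w) (apply_word w v) = v.
Proof.
elim: w v => [//|i w IHw] v /=.
by rewrite rev_cons -cats1 apply_word_cat /= reflect_pointK IHw.
Qed.

Definition simple_root i : vec :=
  match val i with 0%nat => (1, 0, 0) | 1%nat => (0, 1, 0) | _ => (0, 0, 1) end.

(** The image of a simple root by the group element that [w] spells. *)
Definition root w i : vec := foldr reflect_root (simple_root i) w.

(** The reflection in the mirror of [root w i]. *)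
Definition mirror w i : seq 'I_3 := w ++ i :: rev w.

Lemma cartan_root w i : cartan (root w i) (root w i) = 2.
Proof.
elim: w => [|j w IHw] /=; last by rewrite cartan_reflect.
by case: (ord3P i) => -> /=; ring.
Qed.

Lemma pairing_root w i v :
  pairing (root w i) v = pairing (simple_root i) (apply_word (rev w) v).
Proof.
elim: w v => [//|j w IHw] v /=.
by rewrite pairing_reflect IHw rev_cons -cats1 apply_word_cat.
Qed.

Lemma pairing_mirror w i v :
  pairing (root w i) (apply_word (mirror w i) v) = - pairing (root w i) v.
Proof.
rewrite !pairing_root /mirror apply_word_cat apply_word_revK /=.
by case: (apply_word _ v) => [[x y] z]; case: (ord3P i) => -> /=; ring.
Qed.

(** The form on points dual to the Cartan matrix is, up to a factor,
    height ^ 2 - (c ^ 2 - 3) (x ^ 2 + y ^ 2): it is Lorentzian because c ^ 2 > 3,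
    that is r > 6. *)
Definition height v : R := let: (x, y, z) := v in 2 * z + y + c * x.

(** The interior of the future light cone; nothing requires points to be
    normalised. *)
Definition hyperbolic_plane : set vec := [set v | 0 < height v /\
  (c ^ 2 - 3) * (v.1.1 ^ 2 + v.1.2 ^ 2) < height v ^ 2].

Let d_gt0 : 0 < c ^ 2 - 3. Proof. nra. Qed.

(** The reverse Cauchy-Schwarz inequality between a causal and a timelike vector
    of the same time orientation.  In the coordinates (x, y, height) the functional
    [2 * pairing s] is P x + Q y + g height with P ^ 2 + Q ^ 2 <= d g ^ 2. *)
Lemma causal_functional_pos s v :
  cartan s s <= 0 -> 0 < s.2 -> hyperbolic_plane v -> 0 < pairing s v.
Proof.
case: s v => [[a b] g] [[x y] z] /= sle g0 [L0 Lgt].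
have {L0} : 0 < 2 * z + y + c * x := L0.
move: Lgt => /=.
set L := 2 * z + y + c * x; set d := c * (c * 1) - 3 => Lgt L0.
pose P := 2 * a - c * g; pose Q := 2 * b - g.
have PQ : P ^ 2 + Q ^ 2 <= d * g ^ 2.
  have -> : P ^ 2 + Q ^ 2 = d * g ^ 2 +
    2 * (2 * (a * a + b * b + g * g) - c * (a * g + a * g) - (b * g + b * g)).
    by rewrite /P /Q /d; ring.
  lra.
have d0 : 0 < d by have := d_gt0; rewrite /d; lra.
have : 0 < P * x + Q * y + g * L.
  have CS : (P * x + Q * y) ^ 2 <= (P ^ 2 + Q ^ 2) * (x ^ 2 + y ^ 2).
    have := pow2_ge_0 (P * y - Q * x); nra.
  have x2 := pow2_ge_0 x. have y2 := pow2_ge_0 y.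
  have lt2 : (P * x + Q * y) ^ 2 < (g * L) ^ 2.
    apply: Rle_lt_trans CS _.
    apply: (Rle_lt_trans _ (d * g ^ 2 * (x ^ 2 + y ^ 2))).
      by apply: Rmult_le_compat_r => //; lra.
    have g2 : 0 < g ^ 2 by nra.
    have -> : (g * L) ^ 2 = g ^ 2 * L ^ 2 by ring.
    have -> : d * g ^ 2 * (x ^ 2 + y ^ 2) = g ^ 2 * (d * (x ^ 2 + y ^ 2)) by ring.
    apply: Rmult_lt_compat_l => //; rewrite /d /= in Lgt *; lra.
  have gL : 0 < g * L by nra.
  by apply: Rnot_le_lt => le; nra.
have -> : P * x + Q * y + g * L = 2 * (a * x + b * y + g * z).
  by rewrite /P /Q /L; ring.
lra.
Qed.

(** Mirrors that do not cross: when [cartan s t <= -2] the sum of the two roots is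
    causal, so no point of the plane is on the negative side of both. *)
Lemma disjoint_half_planes s t v :
  cartan s s = 2 -> cartan t t = 2 -> cartan s t <= -2 -> 0 < s.2 + t.2 ->
  hyperbolic_plane v -> 0 < pairing s v + pairing t v.
Proof.
case: s t => [[a b] g] [[a' b'] g'] ss tt st gg Sv.
have -> : pairing (a, b, g) v + pairing (a', b', g') v =
          pairing (a + a', b + b', g + g') v.
  by case: v {Sv} => [[x y] z] /=; ring.
apply: causal_functional_pos => //.
have -> : cartan (a + a', b + b', g + g') (a + a', b + b', g + g') =
  cartan (a, b, g) (a, b, g) + cartan (a', b', g') (a', b', g') +
  2 * cartan (a, b, g) (a', b', g').
  by move=> /=; ring.
lra.
Qed.

(** Only R_3 changes the height; that it keeps it positive is again a
    Cauchy-Schwarz estimate. *)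
Lemma hyperbolic_plane_reflect i v :
  hyperbolic_plane v -> hyperbolic_plane (reflect_point i v).
Proof.
case: v => [[x y] z]; rewrite /hyperbolic_plane /=; case: (ord3P i) => -> /= [L0 Lgt].
- split; nra.
- split; nra.
split; last first.
  apply: Rminus_gt_0_lt; move: (Rgt_minus _ _ Lgt); nra.
have d0 := d_gt0; pose d := c ^ 2 - 3.
pose L := 2 * z + y + c * x; pose u := y + c * x.
have -> : 2 * - z + (y + z) + c * (x + c * z) = ((2 + d) * L - d * u) / 2.
  by rewrite /d /L /u; field.
have {}L0 : 0 < L by exact: L0.
have {}Lgt : d * (x ^ 2 + y ^ 2) < L ^ 2 by rewrite /d /L /=; lra.
have {}d0 : 0 < d by exact: d0.
have u2 : u ^ 2 <= (4 + d) * (x ^ 2 + y ^ 2).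
  by rewrite /u /d; have := pow2_ge_0 (x - c * y); nra.
have du2 : (d * u) ^ 2 < ((2 + d) * L) ^ 2.
  apply: (Rle_lt_trans _ (d * (4 + d) * (d * (x ^ 2 + y ^ 2)))).
    have -> : (d * u) ^ 2 = d ^ 2 * u ^ 2 by ring.
    have -> : d * (4 + d) * (d * (x ^ 2 + y ^ 2)) =
      d ^ 2 * ((4 + d) * (x ^ 2 + y ^ 2)) by ring.
    by apply: Rmult_le_compat_l => //; nra.
  apply: (Rlt_trans _ (d * (4 + d) * L ^ 2)); last nra.
  by apply: Rmult_lt_compat_l => //; nra.
suff : d * u < (2 + d) * L by lra.
have dL : 0 <= (2 + d) * L by nra.
by apply: Rnot_le_lt => le; have := pow_incr _ _ 2 (conj dL le); lra.
Qed.

Lemma hyperbolic_plane_apply_word w v :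
  hyperbolic_plane v -> hyperbolic_plane (apply_word w v).
Proof.
by elim: w => [//|i w IHw] Sv /=; exact/hyperbolic_plane_reflect/IHw.
Qed.

(** * Two mirrors far from each other and from the triangle *)

(** The words (R_1 R_3 R_1 R_3 R_2) ^ 2 R_1 R_3 and (R_1 R_3 R_2) ^ 3 R_1 R_3 come
    from an enumeration of the roots by length.  The inequalities below hold for
    all c >= 9 / 5 at once, so one pair of mirrors serves every r >= 7. *)
Definition wordA := [:: i1; i3; i1; i3; i2; i1; i3; i1; i3; i2; i1; i3].
Definition wordB := [:: i1; i3; i2; i1; i3; i2; i1; i3; i2; i1; i3].

Definition rootA := root wordA i1.
Definition rootB := root wordB i1.

(* In terms of d = c ^ 2 - 3 the coordinates have positive coefficients, and the
   scalar products needed have negative ones except for one constant term. *)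
Let d := c ^ 2 - 3.

Lemma rootAE : rootA =
  (8 + 30 * d + 39 * d ^ 2 + 25 * d ^ 3 + 8 * d ^ 4 + d ^ 5,
   c * (2 + 3 * d + d ^ 2), c * (5 + 15 * d + 14 * d ^ 2 + 6 * d ^ 3 + d ^ 4)).
Proof.
by rewrite /d /rootA /root /=; congr (_, _, _); ring.
Qed.

Lemma rootBE : rootB =
  (7 + 23 * d + 22 * d ^ 2 + 8 * d ^ 3 + d ^ 4,
   c * (2 + 3 * d + d ^ 2), c * (4 + 10 * d + 6 * d ^ 2 + d ^ 3)).
Proof.
by rewrite /d /rootB /root /=; congr (_, _, _); ring.
Qed.

Let d_ge : 24 / 100 <= d. Proof. rewrite /d; nra. Qed.
Let d2_ge : 57 / 1000 <= d ^ 2. Proof. nra. Qed.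
Let d3_ge : 13 / 1000 <= d ^ 3. Proof. nra. Qed.
Let d4_ge : 0 <= d ^ 4. Proof. nra. Qed.
Let d5_ge : 0 <= d ^ 5. Proof. nra. Qed.
Let d6_ge : 0 <= d ^ 6. Proof. nra. Qed.

Let cp_le (p : R) : p <= - (6 / 5) -> c * p <= - 2. Proof. nra. Qed.

Let cartanE s t : cartan s t = 2 * (s.1.1 * t.1.1 + s.1.2 * t.1.2 + s.2 * t.2)
  - c * (s.1.1 * t.2 + t.1.1 * s.2) - (s.1.2 * t.2 + t.1.2 * s.2).
Proof. by case: s t => [[? ?] ?] [[? ?] ?]. Qed.

Lemma cartan_rootA_rootB : cartan rootA rootB <= -2.
Proof.
have -> : cartan rootA rootB =
    1 - 8 * d - 24 * d ^ 2 - 34 * d ^ 3 - 24 * d ^ 4 - 8 * d ^ 5 - d ^ 6.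
  by rewrite rootAE rootBE cartanE /= /d; ring.
lra.
Qed.

Lemma cartan_rootA_1 : cartan rootA (-1, 0, 0) <= -2.
Proof.
have -> : cartan rootA (-1, 0, 0) =
    - 1 - 10 * d - 21 * d ^ 2 - 18 * d ^ 3 - 7 * d ^ 4 - d ^ 5.
  by rewrite rootAE cartanE /= /d; ring.
lra.
Qed.

Lemma cartan_rootA_2 : cartan rootA (0, 1, 0) <= -2.
Proof.
have -> : cartan rootA (0, 1, 0) =
    c * (- 1 - 9 * d - 12 * d ^ 2 - 6 * d ^ 3 - d ^ 4).
  by rewrite rootAE cartanE /= /d; ring.
apply: cp_le; lra.
Qed.

Lemma cartan_rootA_3 : cartan rootA (0, 0, 1) <= -2.
Proof.
have -> : cartan rootA (0, 0, 1) =
    c * (- 3 * d - 12 * d ^ 2 - 13 * d ^ 3 - 6 * d ^ 4 - d ^ 5).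
  by rewrite rootAE cartanE /= /d; ring.
apply: cp_le; lra.
Qed.

Lemma cartan_rootB_1 : cartan rootB (-1, 0, 0) <= -2.
Proof.
have -> : cartan rootB (-1, 0, 0) =
    - 2 - 12 * d - 16 * d ^ 2 - 7 * d ^ 3 - d ^ 4.
  by rewrite rootBE cartanE /= /d; ring.
lra.
Qed.

Lemma cartan_rootB_2 : cartan rootB (0, 1, 0) <= -2.
Proof.
have -> : cartan rootB (0, 1, 0) = c * (- 4 * d - 4 * d ^ 2 - d ^ 3).
  by rewrite rootBE cartanE /= /d; ring.
apply: cp_le; lra.
Qed.

Lemma cartan_rootB_3 : cartan rootB (0, 0, 1) <= -2.
Proof.
have -> : cartan rootB (0, 0, 1) =
    c * (- 1 - 6 * d - 11 * d ^ 2 - 6 * d ^ 3 - d ^ 4).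
  by rewrite rootBE cartanE /= /d; ring.
apply: cp_le; lra.
Qed.

End Geometry.

(** * The weight of the edge labelled r *)

Section Angle.
Local Open Scope R_scope.

Let sin_step B t : sin (B + t) = 2 * cos t * sin B - sin (B - t).
Proof. by rewrite sin_plus sin_minus; ring. Qed.

(** From sin (4 pi / 7) = sin (3 pi / 7), the number c = 2 cos (pi / 7) is a root
    of c ^ 3 - c ^ 2 - 2 c + 1, which has no root between 17 / 10 and 9 / 5; and
    c >= 2 cos (pi / 6) > 17 / 10. *)
Lemma two_cos_PI7_ge : 9 / 5 <= 2 * cos (PI / 7).
Proof.
have PI0 := PI_RGT_0.
set t := PI / 7; set c := 2 * cos t.
have c_gt : 17 / 10 < c.
  have : cos (PI / 6) <= cos t by apply: cos_decr_1; rewrite /t; lra.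
  have : 17 / 10 < sqrt 3.
    by rewrite -(sqrt_Rsqr (17 / 10)); [apply: sqrt_lt_1; rewrite /Rsqr; lra | lra].
  rewrite /c cos_PI6; lra.
have s0 : 0 < sin t by apply: sin_gt_0; rewrite /t; lra.
have s2 : sin (t + t) = c * sin t.
  by rewrite sin_step Rminus_diag sin_0 -/c; ring.
have s3 : sin (t + t + t) = (c ^ 2 - 1) * sin t.
  rewrite sin_step s2 -/c; have -> : t + t - t = t by ring.
  ring.
have s4 : sin (t + t + t + t) = (c ^ 3 - 2 * c) * sin t.
  rewrite sin_step s3 -/c; have -> : t + t + t - t = t + t by ring.
  rewrite s2; ring.
have s34 : sin (t + t + t + t) = sin (t + t + t).
  by rewrite -[RHS]sin_PI_x; congr sin; rewrite /t; field.
have : (c ^ 3 - c ^ 2 - 2 * c + 1) * sin t = 0.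
  by move: s34; rewrite s3 s4; lra.
case/Rmult_integral => [c0|]; last lra.
by apply: Rnot_lt_le => lt; nra.
Qed.

Variables (r : nat) (hr : (7 <= r)%N).

Let theta := PI / INR r.
Definition edge_weight := 2 * cos theta.
Let c := edge_weight.

Let r_ge7 : 7 <= INR r.
Proof.
have -> : 7 = INR 7 by rewrite INR_IZR_INZ.
by apply: le_INR; apply/leP.
Qed.

Let theta0 : 0 < theta.
Proof. by apply: Rdiv_lt_0_compat; [exact: PI_RGT_0 | lra]. Qed.

Let theta7 : theta <= PI / 7.
Proof.
apply: Rmult_le_compat_l; first by have := PI_RGT_0; lra.
by apply: Rinv_le_contravar; lra.
Qed.

Lemma edge_weight_ge : 9 / 5 <= edge_weight.
Proof.
apply: (Rle_trans _ _ _ two_cos_PI7_ge); rewrite /edge_weight.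
have := PI_RGT_0 => PI0.
suff : cos (PI / 7) <= cos theta by lra.
by apply: cos_decr_1; have := theta0; have := theta7; lra.
Qed.

Let s0 : 0 < sin theta.
Proof. by have := PI_RGT_0 => PI0; apply: sin_gt_0; have := theta7; lra. Qed.

Let rot (v : vec) : vec := reflect_point c i3 (reflect_point c i1 v).

(* The k-th power turns the (x, z)-plane by 2 k theta.  The coordinate y is
   controlled through the functional fixed by R_1 and R_3. *)
Let rot_iter k x y z : exists y',
  iter k rot (x, y, z) =
    ((sin (INR k * (2 * theta) + theta) * x + sin (INR k * (2 * theta)) * z)
       / sin theta,
     y',
     - (sin (INR k * (2 * theta)) * x + sin (INR k * (2 * theta) - theta) * z)
       / sin theta)
  /\ (4 - c ^ 2) * y' + c * (iter k rot (x, y, z)).1.1 + 2 * (iter k rot (x, y, z)).2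
     = (4 - c ^ 2) * y + c * x + 2 * z.
Proof.
elim: k => [|k [y' [IHk inv]]].
  exists y; split=> //=; rewrite !Rmult_0_l sin_0 Rplus_0_l Rminus_0_l sin_neg.
  by congr (_, _, _); field; lra.
rewrite iterS; set p := iter k rot _ in IHk inv *.
exists (rot p).1.2; split; last first.
  rewrite -inv; have -> : y' = p.1.2 by rewrite IHk.
  by case: (p) => [[a b] e] /=; ring.
have -> : rot p = ((rot p).1.1, (rot p).1.2, (rot p).2) by case: (rot p) => [[]].
set A := INR k * (2 * theta) in IHk.
have -> : INR k.+1 * (2 * theta) = A + theta + theta by rewrite S_INR /A; ring.
have e1 : sin (A + theta) = c * sin A - sin (A - theta) by exact: sin_step.
have e2 : sin (A + theta + theta) = c * sin (A + theta) - sin A.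
  by rewrite sin_step; congr (_ - sin _); ring.
have e3 : sin (A + theta + theta + theta) =
    c * sin (A + theta + theta) - sin (A + theta).
  by rewrite sin_step; congr (_ - sin _); ring.
have e4 : A + theta + theta - theta = A + theta by ring.
rewrite e4 e3 e2 e1 IHk /=; rewrite e1.
by congr (_, _, _); field; lra.
Qed.

Lemma rotation_order v : iter r rot v = v.
Proof.
case: v => [[x y] z]; have [y' [E inv]] := rot_iter r x y z.
move: inv; rewrite E /=.
have -> : INR r * (2 * theta) = 2 * PI by rewrite /theta; field; lra.
have -> : sin (2 * PI - theta) = - sin theta.
  by rewrite sin_minus sin_2PI cos_2PI; ring.
rewrite sin_plus sin_2PI cos_2PI.
have -> : (0 * cos theta + 1 * sin theta) * x + 0 * z = sin theta * x by ring.
have -> : - (0 * x + - sin theta * z) = sin theta * z by ring.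
have cancel a : sin theta * a / sin theta = a by field; lra.
rewrite !cancel => inv; congr (_, _, _).
have c4 : 4 - c ^ 2 = 4 * sin theta ^ 2.
  by have := sin2_cos2 theta; rewrite /c /edge_weight /Rsqr; nra.
have : (4 - c ^ 2) * (y' - y) = 0 by lra.
by case/Rmult_integral; [rewrite c4; nra | lra].
Qed.

End Angle.

(** * The regions of the ping-pong *)

Section Regions.
Local Open Scope R_scope.
Variable c : R.
Hypothesis c_ge : 9 / 5 <= c.

Definition regionA : set vec :=
  [set v | hyperbolic_plane c v /\ pairing (rootA c) v < 0].

Definition regionB : set vec :=
  [set v | hyperbolic_plane c v /\ pairing (rootB c) v < 0].

Definition regionD : set vec :=
  [set v | [/\ hyperbolic_plane c v, 0 <= pairing (rootA c) v
              & 0 <= pairing (rootB c) v]].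

(** The region beyond side 1.  That y and z have the same sign makes it a part of
    a chamber of <R_2, R_3>, hence disjoint from its images under this group. *)
Definition wedge : set vec := [set v | [/\ v.1.1 < 0, 0 < v.1.2 & 0 < v.2]].

(** The product of the reflections in two disjoint mirrors: a hyperbolic
    translation along their common perpendicular. *)
Definition shift : seq 'I_3 := mirror wordB i1 ++ mirror wordA i1.

Lemma regionAB_D v : (regionA `|` regionB) v -> ~ regionD v.
Proof. by case=> [] [_ neg] [_ ? ?]; lra. Qed.

Let rootA3 : 0 < (rootA c).2.
Proof.
rewrite rootAE; set d := c ^ 2 - 3.
change (0 < c * (5 + 15 * d + 14 * d ^ 2 + 6 * d ^ 3 + d ^ 4)).
have d0 : 0 < d by rewrite /d; nra.
have d2 := pow_lt d 2 d0; have d3 := pow_lt d 3 d0; have d4 := pow_lt d 4 d0.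
by apply: Rmult_lt_0_compat; lra.
Qed.

Let rootB3 : 0 < (rootB c).2.
Proof.
rewrite rootBE; set d := c ^ 2 - 3.
change (0 < c * (4 + 10 * d + 6 * d ^ 2 + d ^ 3)).
have d0 : 0 < d by rewrite /d; nra.
have d2 := pow_lt d 2 d0; have d3 := pow_lt d 3 d0; have d4 := pow_lt d 4 d0.
by apply: Rmult_lt_0_compat; lra.
Qed.

Let cartan1 : cartan c (-1, 0, 0) (-1, 0, 0) = 2. Proof. by rewrite /=; ring. Qed.
Let cartan2 : cartan c (0, 1, 0) (0, 1, 0) = 2. Proof. by rewrite /=; ring. Qed.
Let cartan3 : cartan c (0, 0, 1) (0, 0, 1) = 2. Proof. by rewrite /=; ring. Qed.

Lemma half_plane_wedge s v :
  cartan c s s = 2 -> 0 < s.2 -> cartan c s (-1, 0, 0) <= -2 ->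
  cartan c s (0, 1, 0) <= -2 -> cartan c s (0, 0, 1) <= -2 ->
  hyperbolic_plane c v -> pairing s v < 0 -> wedge v.
Proof.
move=> ss s3 b1 b2 b3 Sv neg.
have s0 : 0 < s.2 + 0 by lra.
have s1 : 0 < s.2 + 1 by lra.
have := disjoint_half_planes c_ge ss cartan1 b1 s0 Sv.
have := disjoint_half_planes c_ge ss cartan2 b2 s0 Sv.
have := disjoint_half_planes c_ge ss cartan3 b3 s1 Sv.
move: neg; move: (pairing s v) => p; case: v {Sv} => [[x y] z] /= *.
by split=> /=; lra.
Qed.

Lemma regionAB_wedge v : (regionA `|` regionB) v -> wedge v.
Proof.
case=> [] [Sv neg].
  exact: half_plane_wedge (cartan_root _ _ _) rootA3 (cartan_rootA_1 c_ge)
    (cartan_rootA_2 c_ge) (cartan_rootA_3 c_ge) Sv neg.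
exact: half_plane_wedge (cartan_root _ _ _) rootB3 (cartan_rootB_1 c_ge)
  (cartan_rootB_2 c_ge) (cartan_rootB_3 c_ge) Sv neg.
Qed.

(** The nontrivial elements of <R_1, R_2>, <R_3>, <R_1 R_2> and <R_2 R_3>. *)
Definition displacing : seq (seq 'I_3) :=
  [:: [:: i1]; [:: i2]; [:: i1; i2]; [:: i3]; [:: i2; i3]; [:: i3; i2]].

(** Each of these elements moves the wedge off itself: after it, x is positive or
    one of y, z is negative. *)
Lemma displacing_D w v : w \in displacing -> (regionA `|` regionB) v ->
  regionD (apply_word c w v).
Proof.
move=> ww ABv; have Sv : hyperbolic_plane c v by case: ABv => -[].
have Sw : hyperbolic_plane c (apply_word c w v).
  exact: hyperbolic_plane_apply_word.
have Nw : ~ wedge (apply_word c w v).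
  have := regionAB_wedge ABv; case: v {ABv Sv Sw} => [[x y] z] [/= x0 y0 z0].
  by move: ww; rewrite !inE; do 5?[case/orP]; move/eqP->; case=> /=; lra.
by split=> //; apply: Rnot_lt_le => neg; apply: Nw; apply: regionAB_wedge;
  [left | right].
Qed.

Let rootAB_pos v :
  hyperbolic_plane c v -> 0 < pairing (rootA c) v + pairing (rootB c) v.
Proof.
apply: (disjoint_half_planes c_ge) (cartan_rootA_rootB c_ge) _.
- exact: cartan_root.
- exact: cartan_root.
by have := rootA3; have := rootB3; lra.
Qed.

Let pairing_mirrorA v :
  pairing (rootA c) (apply_word c (mirror wordA i1) v) = - pairing (rootA c) v.
Proof. exact: pairing_mirror. Qed.

Let pairing_mirrorB v :
  pairing (rootB c) (apply_word c (mirror wordB i1) v) = - pairing (rootB c) v.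
Proof. exact: pairing_mirror. Qed.

(** The reflection in A carries the complement of the half-plane A into A, hence off
    B; the reflection in B then carries it into B. *)
Lemma shift_B v : (regionD `|` regionB) v -> regionB (apply_word c shift v).
Proof.
move=> DBv; have Sv : hyperbolic_plane c v by case: DBv => -[].
have SA : hyperbolic_plane c (apply_word c (mirror wordA i1) v).
  exact: hyperbolic_plane_apply_word.
have Av : 0 <= pairing (rootA c) v.
  by case: DBv => [[//]|[_ neg]]; have := rootAB_pos Sv; lra.
split; first exact: hyperbolic_plane_apply_word.
rewrite /shift apply_word_cat pairing_mirrorB.
by have := rootAB_pos SA; rewrite pairing_mirrorA; lra.
Qed.

Lemma shift_A v : (regionD `|` regionA) v -> regionA (apply_word c (rev shift) v).
Proof.
have -> : rev shift = mirror wordA i1 ++ mirror wordB i1 by [].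
move=> DAv; have Sv : hyperbolic_plane c v by case: DAv => -[].
have SB : hyperbolic_plane c (apply_word c (mirror wordB i1) v).
  exact: hyperbolic_plane_apply_word.
have Bv : 0 <= pairing (rootB c) v.
  by case: DAv => [[//]|[_ neg]]; have := rootAB_pos Sv; lra.
split; first exact: hyperbolic_plane_apply_word.
rewrite apply_word_cat pairing_mirrorA.
by have := rootAB_pos SB; rewrite pairing_mirrorB; lra.
Qed.

Lemma regionA_nonempty : exists v, regionA v.
Proof.
exists (apply_word c (rev shift) (0, 0, 1)); apply: shift_A; left.
have SO : hyperbolic_plane c (0, 0, 1) by split=> /=; nra.
have NO : ~ wedge (0, 0, 1) by case=> /=; lra.
by split=> //; apply: Rnot_lt_le => neg; apply: NO; apply: regionAB_wedge;
  [left | right].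
Qed.

End Regions.

(** What the triangle group and the extended one have in common, so that
    ping-pong is played once for both. *)
Section PlaneAction.
Variable c : R.
Hypothesis c_ge : Rle (9 / 5) c.
Variables (G : groupType) (act : G -> vec -> vec).
Hypothesis act1 : forall v, act 1 v = v.
Hypothesis actM : forall g h v, act (g * h) v = act g (act h v).
Variables (Gamma : bool -> set G) (gens : seq G) (h : G).
Hypothesis countG : countable [set: G].
Hypothesis gens_gen : forall K, is_subgroup K ->
  (forall x, x \in gens -> K x) -> K = [set: G].
Hypothesis Gamma_subgroup : forall b, is_subgroup (Gamma b).
Hypothesis Gamma_gen : forall K, is_subgroup K ->
  (forall b, Gamma b `<=` K) -> K = [set: G].
Hypothesis Gamma_act : forall b g, Gamma b g -> g = 1 \/
  exists2 w, w \in displacing & act g =1 apply_word c w.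
Hypothesis Gamma_neq1 : exists b, ~ (Gamma b `<=` [set 1]).
Hypothesis h_act : act h =1 apply_word c shift.

Theorem plane_action_uncountable : ~ countable (max_inf_classes G).
Proof.
have [q Aq] := regionA_nonempty c_ge.
have [b0 /existsNP[g0 /not_implyP[Gg0 /eqP g0_neq1]]] := Gamma_neq1.
apply: (@pingpong_uncountable G vec act act1 actM Gamma gens Gamma_subgroup Gamma_gen
  gens_gen countG h (regionA c) (regionB c) (regionD c) _ _ _ _ q b0 g0) => //.
- exact: regionAB_D.
- move=> b g v /Gamma_act[-> //|[w ww gw] _ ABv]; rewrite gw.
  exact: displacing_D.
- by move=> v DBv; rewrite h_act; exact: shift_B.
- move=> v DAv.
  have -> : act h^-1 v = apply_word c (rev shift) v; last exact: shift_A.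
  have {1}-> : v = act h (apply_word c (rev shift) v).
    by rewrite h_act -{1}[shift]revK apply_word_revK.
  by rewrite -actM mulVg act1.
- exact/eqP.
Qed.

End PlaneAction.

(** * The triangle groups *)

Section Presented.
Variables (I : finType) (rels : seq (word I)).
Local Notation G := (presented rels).
Local Notation gen := (@generator I rels).

Lemma weval_wordX (H : groupType) (f : I -> H) (w : word I) n :
  weval f (wordX w n) = weval f w ^+ n.
Proof.
elim: n => [//|n IHn]; rewrite expgS -IHn -weval_cat.
by [].
Qed.

Lemma presented_countable : countable [set: G].
Proof.
apply: (@sub_countable _ _ _ (word_class rels @` [set: word I])).
  by apply: subset_card_le => x _; elim/word_class_ind: x => w; exists w.
exact: sub_countable (card_image_le _ _) (countableP _).
Qed.

Lemma generators_generate (K : set G) : is_subgroup K ->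
  (forall x, x \in [seq gen i | i : I] -> K x) -> K = [set: G].
Proof.
move=> sK Kg; apply/seteqP; split=> // x _; elim/word_class_ind: x => w.
have Kgen i : K (gen i) by apply: Kg; apply: map_f; rewrite mem_enum.
rewrite -weval_generator; elim: w => [|[i b] w IHw] /=; first exact: subgroup1.
by apply: subgroupM => //; case: b => //; exact: subgroupV.
Qed.

End Presented.

Section FiniteSubgroups.
Variable G : groupType.
Implicit Types x y : G.

Lemma is_subgroup_involution x : x * x = 1 ->
  is_subgroup [set g | g = 1 \/ g = x].
Proof.
move=> xx; have xV : x^-1 = x by apply: mulg1_eq.
apply/is_subgroupP; split=> [|g k [->|->] [->|->]] /=; first by left.
all: by rewrite ?invg1 ?xV ?mulg1 ?mul1g; auto.
Qed.

Lemma is_subgroup_cyclic3 x : x * x * x = 1 ->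
  is_subgroup [set g | [\/ g = 1, g = x | g = x^-1]].
Proof.
move=> xxx; have xV : x^-1 = x * x by apply: mulg1_eq; rewrite mulgA.
have xVV : x^-1 * x^-1 = x by rewrite {1}xV mulgK.
apply/is_subgroupP; split=> [|g k [->|->|->] [->|->|->]] /=; first by apply: Or31.
all: rewrite ?invg1 ?invgK ?mulg1 ?mul1g ?mulgV ?mulVg ?xVV -?xV.
all: first [by apply: Or31 | by apply: Or32 | by apply: Or33].
Qed.

Lemma is_subgroup_klein x y : x * x = 1 -> y * y = 1 -> x * y * (x * y) = 1 ->
  is_subgroup [set g | [\/ g = 1, g = x, g = y | g = x * y]].
Proof.
move=> xx yy xyxy.
have xV : x^-1 = x by apply: mulg1_eq.
have yV : y^-1 = y by apply: mulg1_eq.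
have xyV : (x * y)^-1 = x * y by apply: mulg1_eq.
have yx : y * x = x * y by rewrite -xyV invgM xV yV.
have xxy : x * (x * y) = y by rewrite mulgA xx mul1g.
have xyy : x * y * y = x by rewrite -mulgA yy mulg1.
have yxy : y * (x * y) = x by rewrite mulgA yx.
have xyx : x * y * x = y by rewrite -mulgA yx.
apply/is_subgroupP; split=> [|g k [->|->|->|->] [->|->|->|->]] /=; first by apply: Or41.
all: rewrite ?invg1 ?xyV ?xV ?yV ?mulg1 ?mul1g ?xyxy ?xx ?yy ?xxy ?yxy ?xyx ?xyy ?yx.
all: first [by apply: Or41 | by apply: Or42 | by apply: Or43 | by apply: Or44].
Qed.

End FiniteSubgroups.

Section TriangleGroups.
Variable (r : nat).
Hypothesis hr : (7 <= r)%N.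

Let c := edge_weight r.
Let c_ge : Rle (9 / 5) c. Proof. exact: edge_weight_ge. Qed.

Local Notation E := (ext_triangle 2 3 r).
Local Notation Delta := (triangle 2 3 r).

(** Generators of the extended group act as involutions, so the exponents of the
    letters can be dropped. *)
Definition letters (w : word 'I_3) : seq 'I_3 := [seq a.1 | a <- w].

Lemma apply_word_wordX w n v :
  apply_word c (letters (wordX w n)) v = iter n (apply_word c (letters w)) v.
Proof.
by elim: n => [//|n IHn] /=; rewrite /letters map_cat apply_word_cat -IHn.
Qed.

(** The defining relators act trivially; for the last one this is the order r of
    the rotation R_3 R_1. *)
Lemma apply_word_weq u w : weq (ext_triangle_rels 2 3 r) u w ->
  forall v, apply_word c (letters u) v = apply_word c (letters w) v.
Proof.
elim=> {u w} [//|u w _ IH v|u w x _ uw _ wx v|u a w v|u s w rs v].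
- by rewrite IH.
- by rewrite uw wx.
- by rewrite /letters !map_cat !apply_word_cat /= reflect_pointK.
rewrite /letters !map_cat !apply_word_cat; congr (apply_word _ _ _).
move: (apply_word c _ v) => {u w v} [[x y] z]; move: rs; rewrite !inE.
case/orP=> [/eqP->|]; first exact: reflect_pointK.
case/orP=> [/eqP->|]; first exact: reflect_pointK.
case/orP=> [/eqP->|]; first exact: reflect_pointK.
case/orP=> [/eqP->|]; first by rewrite /=; congr (_, _, _); ring.
case/orP=> [/eqP->|/eqP->]; first by rewrite /=; congr (_, _, _); ring.
rewrite -/(letters _) apply_word_wordX; exact: rotation_order.
Qed.

Definition ext_act (g : E) (v : vec) : vec :=
  apply_word c (letters (repr (g : presented (ext_triangle_rels 2 3 r)))) v.

Lemma ext_actE w v : ext_act (word_class (ext_triangle_rels 2 3 r) w) v =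
  apply_word c (letters w) v.
Proof. exact/apply_word_weq/weq_repr. Qed.

Lemma ext_act1 v : ext_act 1 v = v.
Proof. exact: ext_actE. Qed.

Lemma ext_actM g k v : ext_act (g * k) v = ext_act g (ext_act k v).
Proof.
elim/word_class_ind: g => u; elim/word_class_ind: k => w.
by rewrite [_ * _]pres_mulE !ext_actE /letters map_cat apply_word_cat.
Qed.

Let R_ i : E := generator (ext_triangle_rels 2 3 r) i.

Lemma ext_act_reflection i v : ext_act (R_ i) v = reflect_point c i v.
Proof. exact: ext_actE. Qed.

Let ext_rel s : s \in ext_triangle_rels 2 3 r -> weval R_ s = 1.
Proof. exact: weval_rel. Qed.

Lemma reflectionK i : R_ i * R_ i = 1.
Proof.
have : weval R_ (wordX [:: (i, false)] 2) = 1.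
  by apply: ext_rel; case: (ord3P i) => ->;
    rewrite /ext_triangle_rels !inE eqxx ?orbT.
by rewrite weval_wordX /= mulg1.
Qed.

Let rel12 : (R_ i1 * R_ i2) ^+ 2 = 1.
Proof.
have := @ext_rel (wordX [:: (i1, false); (i2, false)] 2).
rewrite weval_wordX /= !mulg1.
by apply; rewrite /ext_triangle_rels !inE eqxx !orbT.
Qed.

Let rel23 : (R_ i2 * R_ i3) ^+ 3 = 1.
Proof.
have := @ext_rel (wordX [:: (i2, false); (i3, false)] 3).
rewrite weval_wordX /= !mulg1.
by apply; rewrite /ext_triangle_rels !inE eqxx !orbT.
Qed.

Let rel31 : (R_ i3 * R_ i1) ^+ r = 1.
Proof.
have := @ext_rel (wordX [:: (i3, false); (i1, false)] r).
rewrite weval_wordX /= !mulg1.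
by apply; rewrite /ext_triangle_rels !inE eqxx !orbT.
Qed.

Definition reflections (w : seq 'I_3) : E :=
  word_class (ext_triangle_rels 2 3 r) [seq (i, false) | i <- w].

Lemma ext_act_reflections w v : ext_act (reflections w) v = apply_word c w v.
Proof. by rewrite ext_actE /letters -map_comp map_id. Qed.

Theorem ext_triangle_uncountable : ~ countable (max_inf_classes E).
Proof.
pose Gamma b : set E := if b
  then [set g | [\/ g = 1, g = R_ i1, g = R_ i2 | g = R_ i1 * R_ i2]]
  else [set g | g = 1 \/ g = R_ i3].
apply: (@plane_action_uncountable c c_ge E ext_act ext_act1 ext_actM Gamma
  [seq R_ i | i : 'I_3] (reflections shift)).
- exact: presented_countable.
- exact: generators_generate.
- case; first by apply: is_subgroup_klein; rewrite ?reflectionK // -rel12.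
  exact/is_subgroup_involution/reflectionK.
- move=> K sK GK; apply: generators_generate => // x /mapP[i _ ->].
  case: (ord3P i) => ->.
  + by apply: (GK true); apply: Or42.
  + by apply: (GK true); apply: Or43.
  + by apply: (GK false); right.
- have actP w : w \in displacing -> reflections w = 1 \/
    exists2 w', w' \in displacing & ext_act (reflections w) =1 apply_word c w'.
    by right; exists w => // v; exact: ext_act_reflections.
  have R1 i : R_ i = reflections [:: i] by [].
  have R2 : R_ i1 * R_ i2 = reflections [:: i1; i2] by exact: pres_mulE.
  case=> g /=; last by case=> [->|->]; [left | exact: (actP [:: i3])].
  case=> ->; [by left | exact: (actP [:: i1]) | exact: (actP [:: i2]) |].
  by rewrite R2; exact: actP.
- exists false => /(_ (R_ i3)) /= R31.
  have : ext_act (R_ i3) (simple_root i3) = ext_act 1 (simple_root i3).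
    by rewrite R31 //; right.
  rewrite ext_act1 ext_act_reflection /=; case; lra.
- exact: ext_act_reflections.
Qed.

Let T_ i : Delta := generator (triangle_rels 2 3 r) i.

Let tri_rel s : s \in triangle_rels 2 3 r -> weval T_ s = 1.
Proof. exact: weval_rel. Qed.

Let relX : T_ i1 * T_ i1 = 1.
Proof.
have := @tri_rel (wordX [:: (i1, false)] 2).
by rewrite weval_wordX /= !mulg1; apply; rewrite /triangle_rels !inE eqxx ?orbT.
Qed.

Let relY : T_ i2 * T_ i2 * T_ i2 = 1.
Proof.
have := @tri_rel (wordX [:: (i2, false)] 3).
rewrite weval_wordX /= !mulg1 -mulgA.
by apply; rewrite /triangle_rels !inE eqxx ?orbT.
Qed.

Let relXYZ : T_ i1 * T_ i2 * T_ i3 = 1.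
Proof.
have := @tri_rel [:: (i1, false); (i2, false); (i3, false)].
by rewrite /= mulg1 mulgA; apply; rewrite /triangle_rels !inE eqxx ?orbT.
Qed.

Definition rotation (i : 'I_3) : E :=
  match val i with
  | 0%nat => R_ i1 * R_ i2
  | 1%nat => R_ i2 * R_ i3
  | _ => R_ i3 * R_ i1
  end.

Lemma triangle_to_ext_triangle : exists phi : Delta -> E,
  {morph phi : x y / x * y} /\ forall i, phi (T_ i) = rotation i.
Proof.
have rotP s : s \in triangle_rels 2 3 r -> weval rotation s = 1.
  rewrite /triangle_rels !inE.
  case/orP=> [/eqP->|]; first by rewrite weval_wordX /= mulg1.
  case/orP=> [/eqP->|]; first by rewrite weval_wordX /= mulg1.
  case/orP=> [/eqP->|/eqP->]; first by rewrite weval_wordX /= mulg1.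
  rewrite /= mulg1 /rotation /= -!mulgA (mulgA (R_ i2)) reflectionK mul1g.
  by rewrite (mulgA (R_ i3)) reflectionK mul1g reflectionK.
by have [phi [phiP _]] := presented_lift rotP; exists phi.
Qed.

Section Orientation.
Variable phi : Delta -> E.
Hypothesis phiM : {morph phi : x y / x * y}.
Hypothesis phiT : forall i, phi (T_ i) = rotation i.

Let phi1 : phi 1 = 1.
Proof. by apply: (mulgI (phi 1)); rewrite -phiM !mulg1. Qed.

Let phiV x : phi x^-1 = (phi x)^-1.
Proof. by apply: (mulgI (phi x)); rewrite -phiM !mulgV. Qed.

Let reflectionV i : (R_ i)^-1 = R_ i.
Proof. exact/mulg1_eq/reflectionK. Qed.

Let reflections_cons i w : reflections (i :: w) = R_ i * reflections w.
Proof. by rewrite /reflections [RHS]pres_mulE. Qed.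

Lemma pair_lift i j : exists g, phi g = R_ i * R_ j.
Proof.
case: (ord3P i) => ->; case: (ord3P j) => ->.
- by exists 1; rewrite reflectionK.
- by exists (T_ i1); rewrite phiT.
- by exists (T_ i3)^-1; rewrite phiV phiT invgM !reflectionV.
- by exists (T_ i1)^-1; rewrite phiV phiT invgM !reflectionV.
- by exists 1; rewrite reflectionK.
- by exists (T_ i2); rewrite phiT.
- by exists (T_ i3); rewrite phiT.
- by exists (T_ i2)^-1; rewrite phiV phiT invgM !reflectionV.
- by exists 1; rewrite reflectionK.
Qed.

(** The image of the triangle group is the orientation-preserving subgroup; in
    particular it contains the translation, a product of two reflections. *)
Lemma even_word_lift w : ~~ odd (size w) -> exists g, phi g = reflections w.
Proof.
have [n] := ubnP (size w); elim: n w => [//|n IHn] [|i [|j w]] //=.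
  by exists 1.
rewrite negbK => wn even_w.
have [|k phik] := IHn w _ even_w; first by rewrite ltnW.
have [g phig] := pair_lift i j; exists (g * k).
by rewrite phiM phig phik !reflections_cons mulgA.
Qed.

Theorem triangle_uncountable_of_morphism : ~ countable (max_inf_classes Delta).
Proof.
have [h phih] : exists h, phi h = reflections shift by exact: even_word_lift.
pose Gamma b : set Delta := if b then [set g | g = 1 \/ g = T_ i1]
  else [set g | [\/ g = 1, g = T_ i2 | g = (T_ i2)^-1]].
have GamX : Gamma true (T_ i1) by right.
have GamY : Gamma false (T_ i2) by apply: Or32.
apply: (@plane_action_uncountable c c_ge Delta (fun g => ext_act (phi g)) _ _ Gamma
  [seq T_ i | i : 'I_3] h).
- by move=> v; rewrite phi1 ext_act1.
- by move=> g k v; rewrite phiM ext_actM.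
- exact: presented_countable.
- exact: generators_generate.
- by case; [exact: is_subgroup_involution | exact: is_subgroup_cyclic3].
- move=> K sK GK; apply: generators_generate => // x /mapP[i _ ->].
  have KX := GK _ _ GamX; have KY := GK _ _ GamY.
  case: (ord3P i) => -> //; rewrite -/(T_ i3) -(mulg1_eq relXYZ).
  by apply: subgroupV => //; exact: subgroupM.
- have actP g w : w \in displacing -> phi g = reflections w -> g = 1 \/
    exists2 w', w' \in displacing & ext_act (phi g) =1 apply_word c w'.
    by move=> ww ->; right; exists w => // v; exact: ext_act_reflections.
  have R2 i j : R_ i * R_ j = reflections [:: i; j].
    by rewrite !reflections_cons mulg1.
  case=> g /=; case=> ->; try by left.
  + by apply: (actP _ [:: i1; i2]); rewrite // phiT -R2.
  + by apply: (actP _ [:: i2; i3]); rewrite // phiT -R2.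
  + by apply: (actP _ [:: i3; i2]); rewrite // phiV phiT invgM !reflectionV -R2.
- exists false => /(_ _ GamY) /= Y1.
  have : ext_act (phi (T_ i2)) (simple_root i3) = simple_root i3.
    by rewrite Y1 phi1 ext_act1.
  by rewrite phiT ext_actM !ext_act_reflection /=; case; lra.
- by move=> v; rewrite phih; exact: ext_act_reflections.
Qed.

End Orientation.

Theorem triangle_uncountable : ~ countable (max_inf_classes Delta).
Proof.
have [phi [phiM phiT]] := triangle_to_ext_triangle.
exact: triangle_uncountable_of_morphism phiM phiT.
Qed.

End TriangleGroups.

Theorem proposition11 (r : nat) (hr : (7 <= r)%N) :
  ~ countable (max_inf_classes (triangle 2 3 r)) /\
  ~ countable (max_inf_classes (ext_triangle 2 3 r)).
Proof.
split; [exact: triangle_uncountable | exact: ext_triangle_uncountable].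
Qed.
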